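(* Let $n$ be a positive integer and let $S=S_1\cup S_2\subseteq T_{8n}\setminus\{e\}$ be nonempty with $S=S^{-1}$, where $S_1\subseteq\langle a^2\rangle$ and $S_2\subseteq\langle a\rangle b\cup\langle a\rangle b^3$. Then the Cayley graph $\mathrm{Cay}(T_{8n},S)$ is integral if and only if the following conditions hold for all $j=0,1,\dots,7$ and all $k,h=1,2,\dots,n-1$: (1) $S_1\in B(\langle a^2\rangle)$; (2) $\chi_j(S)$ and $\varphi_k(S_1)$ are integers; (3) $2\varphi_k(S_2^2)$ and $2\psi_h(S_2^2)$ are perfect squares.
   Context: $T_{8n}=\langle a,b\mid a^{2n}=b^8=e,\ a^n=b^4,\ b^{-1}ab=a^{-1}\rangle$ is a group of order $8n$; its elements are $a^r b^s$ with $0\le r\le 2n-1$, $0\le s\le 3$ (each written uniquely in this form). For a finite group $G$ with identity $e$ and a nonempty $S\subseteq G\setminus\{e\}$ with $S=S^{-1}$, $\mathrm{Cay}(G,S)$ is the graph with vertex set $G$ in which $x,y$ are adjacent iff $xy^{-1}\in S$. A graph is integral if all eigenvalues of its adjacency matrix are integers. A perfect square means the square of an integer. For a finite group $G$, $B(G)$ is the Boolean algebra of subsets of $G$ generated by the subgroups of $G$, i.e. the sets obtained from subgroups of $G$ by finite intersections, unions and complements (in $G$). Let $\omega=\exp(\pi\mathbf i/4)$, $\varepsilon=\exp(2\pi\mathbf i/n)$, $\xi=\exp(\pi\mathbf i/n)$, $\mathbf i^2=-1$. The characters $\chi_j$ ($0\le j\le 7$), $\varphi_k$ ($1\le k\le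 n-1$), $\psi_h$ ($1\le h\le n-1$) of $T_{8n}$ have the following values ($0\le r\le 2n-1$). If $n$ is odd: $\chi_j(a^rb^s)=(-1)^{rj}\omega^{sj}$ for $s=0,1,2,3$; $\varphi_k(a^r)=\varepsilon^{kr}+\varepsilon^{-kr}$, $\varphi_k(a^rb^2)=(-1)^k(\varepsilon^{kr}+\varepsilon^{-kr})$, $\varphi_k(a^rb)=\varphi_k(a^rb^3)=0$; $\psi_h(a^r)=(-1)^{rh+r}(\xi^{hr}+\xi^{-hr})$, $\psi_h(a^rb^2)=\mathbf i(-1)^{rh+r}(\xi^{hr}+\xi^{-hr})$, $\psi_h(a^rb)=\psi_h(a^rb^3)=0$. If $n$ is even: $\chi_j(a^rb^s)=\omega^{sj}$ for $j\in\{0,2,4,6\}$ and $\chi_j(a^rb^s)=(-1)^r\omega^{s(j-1)}$ for $j\in\{1,3,5,7\}$, $s=0,1,2,3$; $\varphi_k(a^r)=\xi^{kr}+\xi^{-kr}$, $\varphi_k(a^rb^2)=\xi^{kr}+\xi^{-kr}$ for $k$ even and $\mathbf i(\xi^{kr}+\xi^{-kr})$ for $k$ odd, $\varphi_k(a^rb)=\varphi_k(a^rb^3)=0$; $\psi_h(a^r)=\xi^{hr}+\xi^{-hr}$, $\psi_h(a^rb^2)=-(\xi^{hr}+\xi^{-hr})$ for $h$ even and $-\mathbf i(\xi^{hr}+\xi^{-hr})$ for $h$ odd, $\psi_h(a^rb)=\psi_h(a^rb^3)=0$. For a character $\chi$ and subsets $A,B$ of the group: $\chi(\emptyset)=0$,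 $\chi(A)=\sum_{x\in A}\chi(x)$, $\chi(AB)=\sum_{x\in A,\,y\in B}\chi(xy)$ (sum over all pairs, i.e. with multiplicity), and $\chi(A^2)=\chi(AA)$. *)

(* Defs.v *)
From HB Require Import structures.
From mathcomp Require Import all_boot all_order all_fingroup all_algebra.
From mathcomp Require Import all_solvable all_field.

Set Implicit Arguments.
Unset Strict Implicit.
Unset Printing Implicit Defensive.

Import GroupScope GRing.Theory Num.Theory.
Local Open Scope ring_scope.

(* The whole of gT is T_{8n} with a and b as its defining generators.  The
   first clause fixes the isomorphism type through the library's presentations;
   the others say that a, b are generators satisfying the relations.  Any such
   pair is the image of the defining pair under an automorphism, because a
   surjective endomorphism of a finite group is bijective. *)
Definition is_T8n (n : nat) (gT : finGroupType) (a b : gT) : Prop :=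
  [/\ [set: gT] \isog Grp (x : y :
        x ^+ (2 * n), y ^+ 8, x ^+ n = y ^+ 4, x ^ y = x^-1),
      <<[set a; b]>>%g = [set: gT],
      (a ^+ (2 * n) = 1)%g /\ (b ^+ 8 = 1)%g,
      (a ^+ n = b ^+ 4)%g &
      (b^-1 * a * b = a^-1)%g].

Section BooleanAlgebra.
Variables (gT : finGroupType) (G : {group gT}).

(* Complements are taken in G. *)
Inductive in_B : {set gT} -> Prop :=
| in_B_subgroup (H : {group gT}) of H \subset G : in_B H
| in_B_setI A B of in_B A & in_B B : in_B (A :&: B)
| in_B_setU A B of in_B A & in_B B : in_B (A :|: B)
| in_B_setC A of in_B A : in_B (G :\: A).

End BooleanAlgebra.

Definition cay_rel (gT : finGroupType) (S : {set gT}) : rel gT :=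
  fun x y => (x * y^-1)%g \in S.

Definition adjmx (T : finType) (e : rel T) : 'M[algC]_#|T| :=
  \matrix_(i, j) (e (enum_val i) (enum_val j))%:R.

(* Eigenvalues of an integer matrix are algebraic, so none is lost over algC. *)
Definition integral_graph (T : finType) (e : rel T) : Prop :=
  forall z : algC, eigenvalue (adjmx e) z -> z \in Num.int.

Definition perfect_square (z : algC) : Prop :=
  exists m : int, z = (m ^+ 2)%:~R.

(* n.-root (-1) is the n-th root of -1 of least nonnegative argument when
   n > 1, and is -1 when n = 1; so it is exp(pi * i / n) for every n > 0. *)
Definition omega : algC := 4.-root (-1).
Definition xi (n : nat) : algC := n.-root (-1).
Definition eps (n : nat) : algC := xi n ^+ 2.

(* The value at a^r b^s, for r < 2n and s < 4. *)
Definition chi_val (n j r s : nat) : algC :=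
  if odd n then (-1) ^+ (r * j) * omega ^+ (s * j)
  else if odd j then (-1) ^+ r * omega ^+ (s * j.-1)
  else omega ^+ (s * j).

Definition phi_val (n k r s : nat) : algC :=
  if odd n then
    let c := eps n ^+ (k * r) + eps n ^- (k * r) in
    match s with 0 => c | 2 => (-1) ^+ k * c | _ => 0 end
  else
    let c := xi n ^+ (k * r) + xi n ^- (k * r) in
    match s with 0 => c | 2 => if odd k then 'i * c else c | _ => 0 end.

Definition psi_val (n h r s : nat) : algC :=
  let c := xi n ^+ (h * r) + xi n ^- (h * r) in
  if odd n then
    let d := (-1) ^+ (r * h + r) * c in
    match s with 0 => d | 2 => 'i * d | _ => 0 end
  else
    match s with 0 => c | 2 => if odd h then - ('i * c) else - c | _ => 0 end.

Section Characters.
Variables (n : nat) (gT : finGroupType) (a b : gT).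

(* The exponents (r, s) of the normal form x = a^r b^s.  When is_T8n n a b and
   0 < n they exist and are unique, so the None branch is not reached. *)
Definition T8n_exp (x : gT) : nat * nat :=
  if [pick p : 'I_(2 * n) * 'I_4 | x == (a ^+ p.1 * b ^+ p.2)%g] is Some p
  then (nat_of_ord p.1, nat_of_ord p.2) else (0, 0)%N.

Definition chi (j : nat) (x : gT) : algC :=
  let: (r, s) := T8n_exp x in chi_val n j r s.
Definition phi (k : nat) (x : gT) : algC :=
  let: (r, s) := T8n_exp x in phi_val n k r s.
Definition psi (h : nat) (x : gT) : algC :=
  let: (r, s) := T8n_exp x in psi_val n h r s.

End Characters.

Definition char_sum (gT : finGroupType) (f : gT -> algC) (A : {set gT}) : algC :=
  \sum_(x in A) f x.

(* Sum over all pairs, hence with multiplicity; not over the product set. *)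
Definition char_sum_mul (gT : finGroupType) (f : gT -> algC)
    (A B : {set gT}) : algC :=
  \sum_(x in A) \sum_(y in B) f (x * y)%g.

(* Main.v *)
Require Import Defs.
From HB Require Import structures.
From mathcomp Require Import all_boot all_order all_fingroup all_algebra.
From mathcomp Require Import all_solvable all_field.
From mathcomp Require Import zify ring.

(* The group has the two-dimensional representations a |-> diag(l, l^-1),
   b |-> [[0, c], [1, 0]], for l^(2n) = 1 and c^2 = l^n, and they separate the
   functions on the group; so the spectrum of the Cayley graph is the union of
   the spectra of the images of S.  Such an image is [[al, u], [v, al]], where
   P = 2 al is the sum of the trace over S1 (S1 is diagonal and closed under
   inverses) and Q = 2 u v is the sum of the trace over S2 x S2.  Its
   eigenvalues z are the solutions of (2 z - P)^2 = 2 Q; as they are algebraic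
   integers, they are integers as soon as P is an integer and 2 Q a square.
   The traces are the phi_k and psi_h, up to l -> l^-1 and c -> c^-1, when
   l^2 != 1, and the chi_j are found inside the reducible cases l^2 = 1.
   Finally, when all the character sums over S1 are rational, Galois
   conjugation shows that S1 contains, with x, every generator of <[x]>, which
   puts S1 in the Boolean algebra generated by the subgroups. *)

Set Implicit Arguments.
Unset Strict Implicit.
Unset Printing Implicit Defensive.

Import GroupScope GRing.Theory Num.Theory.
Local Open Scope ring_scope.

(** * Roots of unity: the order of the principal root of -1 *)

Lemma sum_expr_unity (F : fieldType) (w : F) g :
  w ^+ g = 1 -> w != 1 -> \sum_(i < g) w ^+ i = 0.
Proof.
move=> wg w1; apply/eqP; have /eqP := subrX1 w g.
by rewrite wg subrr eq_sym mulf_eq0 subr_eq0 (negPf w1).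
Qed.

(* For the g-th roots v of w, the numbers (1 - w) / (1 - v) have sum g, so
   they cannot all lie in the closed unit disc without all being equal to 1. *)
Lemma closer_root (w : algC) g : (1 < g)%N -> w != 0 -> w != 1 ->
  exists2 v : algC, v ^+ g = w & `|1 - v| < `|1 - w|.
Proof.
move=> g1 w0 w1; have g0 : (0 < g)%N by lia.
have [eta eta_g] := C_prim_root_exists g0.
pose v (i : 'I_g) := g.-root w * eta ^+ i.
have vg i : v i ^+ g = w.
  by rewrite exprMn rootCK // exprAC (prim_expr_order eta_g) expr1n mulr1.
have [[i vi]|nv] := altP (@existsP _ (fun i => `|1 - v i| < `|1 - w|)).
  by exists (v i).
have {}nv i : `|1 - w| <= `|1 - v i|.
  have := nv; rewrite negb_exists => /forallP/(_ i).
  by rewrite real_ltNge ?normr_real // negbK.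
have w1_gt0 : 0 < `|1 - w| by rewrite normr_gt0 subr_eq0 eq_sym.
pose P i := \sum_(k < g) v i ^+ k.
have PE i : 1 - w = (1 - v i) * P i.
  by rewrite -(vg i) -opprB subrX1 -mulNr opprB.
have leP i : true -> `|P i| <= 1.
  move=> _; have := nv i; rewrite (PE i) normrM => h.
  have v0 : 0 < `|1 - v i| by apply: (Order.POrderTheory.lt_le_trans w1_gt0).
  by rewrite -(ler_pM2l v0) mulr1.
(* Only the terms k = 0 survive: for 0 < k < g the k-th powers of the [v i] sum to zero. *)
have sumP : \sum_i P i = \sum_(i : 'I_g) 1.
  rewrite exchange_big /= (bigD1 (Ordinal g0)) //= [X in _ + X]big1 => [|k k0].
    by rewrite addr0; apply: eq_bigr => i _; rewrite expr0.
  under eq_bigr do rewrite exprMn -exprM mulnC exprM.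
  rewrite -mulr_sumr sum_expr_unity ?mulr0 //.
    by rewrite exprAC (prim_expr_order eta_g) expr1n.
  rewrite -(prim_order_dvd eta_g) gtnNdvd ?ltn_ord // lt0n.
  by apply: contraNneq k0 => k0; apply/eqP/val_inj.
have P1 := normC_sum_upper leP sumP.
have veq i : v i = w.
  by have := PE i; rewrite P1 // mulr1 => /(congr1 (fun x => 1 - x)); rewrite !subKr.
have /eqP := etrans (veq (Ordinal g0)) (esym (veq (Ordinal g1))).
rewrite /v expr0 expr1 -subr_eq0 -mulrBr mulf_eq0 rootC_eq0 // (negPf w0) /=.
by rewrite subr_eq0 eq_sym -[eta]expr1 -(prim_order_dvd eta_g) gtnNdvd.
Qed.

Lemma norm_1sub (v : algC) : `|v| = 1 -> `|1 - v| ^+ 2 = 2 - 2 * 'Re v.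
Proof.
move=> v1; have := normC2_Re_Im v; rewrite v1 expr1n => v2.
rewrite normC2_Re_Im !raddfB /= (Creal_ReP 1 _) ?rpred1 // (Creal_ImP 1 _) ?rpred1 //.
move: v2; move: ('Re v) ('Im v) => x y v2.
transitivity (1 - 2 * x + (x ^+ 2 + y ^+ 2)); first ring.
by rewrite -v2; ring.
Qed.

(** [n.-root] is pinned down by having the largest real part among the roots in the closed upper
    half plane, so primitivity is extracted from that maximality. *)
Lemma rootCN1_prim n : (0 < n)%N -> (2 * n)%N.-primitive_root (n.-root (-1) : algC).
Proof.
move=> n0; set w := n.-root (-1).
have wn : w ^+ n = -1 by rewrite rootCK.
have N1 : (-1 : algC) != 1 by rewrite eqNr oner_eq0.
have w2n : w ^+ (2 * n) = 1 by rewrite mulnC exprM wn sqrrN expr1n.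
have n2 : (0 < 2 * n)%N by lia.
have [d dw /dvdnP[g def2n]] := prim_order_exists n2 w2n.
(* If g > 1 then a g-th root of w is an n-th root of -1 closer to 1 than w,
   i.e. of larger real part. *)
have godd : odd g.
  apply/negPn/negP => /even_halfK gE; move: wn N1.
  have -> : n = (d * g./2)%N by lia.
  by rewrite exprM (prim_expr_order dw) expr1n => <-; rewrite eqxx.
have [g1|g1] := leqP g 1; first by rewrite def2n (_ : g = 1%N) ?mul1n //; lia.
(* As g is odd, the factor 2 falls to d, so g divides n; since [w ^+ m = -1], every g-th root of [w]
   is then an n-th root of -1. *)
have d_even : ~~ odd d by have := congr1 odd def2n; rewrite !oddM /= godd; case: (odd d).
have [m defd] : exists m, d = (2 * m)%N by exists d./2; lia.
have defn : n = (g * m)%N by nia.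
have wm : w ^+ m = -1.
  have : (w ^+ m) ^+ 2 = 1 by rewrite -exprM mulnC -defd (prim_expr_order dw).
  move/eqP; rewrite sqrf_eq1 => /orP[|] /eqP // wm1.
  by move: N1; rewrite -wn defn mulnC exprM wm1 expr1n eqxx.
have norm1 (y : algC) : y ^+ n = -1 -> `|y| = 1.
  move=> yn; have := normrX n y; rewrite yn normrN1 => /esym/eqP.
  by rewrite pexpr_eq1 // => /eqP.
have w0 : w != 0 by rewrite rootC_eq0 // oppr_eq0 oner_eq0.
have w1 : w != 1 by apply: contraNneq N1 => w1; rewrite -wn w1 expr1n.
have [v vg ltv] := closer_root g1 w0 w1.
have vn : v ^+ n = -1 by rewrite defn exprM vg.
have {}ltv : 'Re w < 'Re v.
  move: ltv; rewrite -(ltr_pXn2r (isT : 0 < 2)%N) ?nnegrE ?normr_ge0 //.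
  by rewrite !norm_1sub ?norm1 // ltrD2l ltrN2 ltr_pM2l ?ltr0n.
suff : 'Re v <= 'Re w by move/(Order.POrderTheory.lt_le_trans ltv); rewrite Order.POrderTheory.ltxx.
(* Maximality concerns the upper half plane; a root below it is replaced by its conjugate, of equal
   real part. *)
have [Iv|Iv] := real_ge0P (Creal_Im v); first by rewrite rootC_Re_max.
rewrite -Re_conj rootC_Re_max ?Im_conj ?oppr_ge0 ?Order.POrderTheory.ltW //.
by rewrite -rmorphXn /= vn rmorphN1.
Qed.

Lemma eigenvalue_int_Aint m (A : 'M[int]_m) (z : algC) :
  eigenvalue (map_mx intr A) z -> z \in Aint.
Proof.
rewrite eigenvalue_root_char => /root_monic_Aint; apply.
  exact: char_poly_monic.
rewrite -map_char_poly; apply/polyOverP => i.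
by rewrite coef_map /= intr_int.
Qed.

(** * Eigenvalues of a Cayley graph through representations *)

Section CayleySpectrum.
Variables (gT : finGroupType) (S : {set gT}).

Lemma cay_eigenvalue_Aint z :
  eigenvalue (adjmx (cay_rel S)) z -> z \in Aint.
Proof.
have -> : adjmx (cay_rel S) =
    map_mx intr (\matrix_(i, j) (cay_rel S (enum_val i) (enum_val j))%:R).
  by apply/matrixP=> i j; rewrite !mxE /= rmorph_nat.
exact: eigenvalue_int_Aint.
Qed.

Lemma cay_eigenvalueP z :
  reflect (exists2 f : gT -> algC, exists x, f x != 0
             & forall y, \sum_(s in S) f (s * y)%g = z * f y)
          (eigenvalue (adjmx (cay_rel S)) z).
Proof.
have sumE (f : gT -> algC) y :
    \sum_x f x * (cay_rel S x y)%:R = \sum_(s in S) f (s * y)%g.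
  rewrite (reindex_inj (mulIg y)) [RHS]big_mkcond /=; apply: eq_bigr => x _.
  by rewrite /cay_rel mulgK; case: (x \in S); rewrite ?mulr1 ?mulr0.
apply: (iffP eigenvalueP) => [[v vA v0] | [f [x fx] fS]].
  have [i vi] := rV0Pn _ v0.
  pose f x := v 0 (enum_rank x).
  exists f => [|y]; first by exists (enum_val i); rewrite /f enum_valK.
  rewrite -(sumE f) (reindex _ (onW_bij _ (enum_val_bij gT))) /=.
  have := congr1 (fun w : 'rV_ _ => w 0 (enum_rank y)) vA.
  rewrite !mxE => <-; apply: eq_bigr => j _.
  by rewrite !mxE /f enum_valK enum_rankK.
exists (\row_i f (enum_val i)); last first.
  by apply/rV0Pn; exists (enum_rank x); rewrite mxE enum_rankK.
apply/rowP => j; rewrite !mxE -fS -sumE.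
rewrite [RHS](reindex _ (onW_bij _ (enum_val_bij gT))) /=.
by apply: eq_bigr => i _; rewrite !mxE.
Qed.

Variables (m : nat) (rho : gT -> 'M[algC]_m).
Hypotheses (rho1 : rho 1%g = 1%:M) (rhoM : {morph rho : x y / (x * y)%g >-> x *m y}).

(** Each coordinate of v rho(y) is an eigenfunction of y; one where v is nonzero does not vanish at
    y = 1. *)
Lemma rep_cay_eigenvalue z :
  eigenvalue (\sum_(s in S) rho s) z -> eigenvalue (adjmx (cay_rel S)) z.
Proof.
move=> /eigenvalueP[v vS v0]; apply/cay_eigenvalueP.
have [i vi] := rV0Pn _ v0.
exists (fun y => (v *m rho y) 0 i); first by exists 1%g; rewrite rho1 mulmx1.
move=> y; transitivity ((v *m (\sum_(s in S) rho s) *m rho y) 0 i).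
  rewrite mulmx_sumr mulmx_suml summxE; apply: eq_bigr => s _.
  by rewrite rhoM mulmxA.
by rewrite vS -scalemxAl mxE.
Qed.

(** The Fourier coefficient [F] of an eigenfunction satisfies F rho(S) = z F, so nonzero vectors of
    its row space are eigenvectors. *)
Lemma cay_rep_eigenvalue (f : gT -> algC) z :
    (forall y, \sum_(s in S) f (s * y)%g = z * f y) ->
    \sum_x f x *: rho x^-1%g != 0 ->
  eigenvalue (\sum_(s in S) rho s) z.
Proof.
set F := \sum_x _ => fS F0.
have FS : F *m (\sum_(s in S) rho s) = z *: F.
  rewrite mulmx_sumr scaler_sumr.
  under [RHS]eq_bigr do rewrite scalerA -fS scaler_suml.
  rewrite exchange_big /=; apply: eq_bigr => s sS.
  rewrite mulmx_suml (reindex_inj (mulgI s)) /=; apply: eq_bigr => x _.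
  by rewrite -scalemxAl -rhoM invMg mulgKV.
have /rowV0Pn[v /submxP[w ->] w0] : F != 0 by [].
apply/eigenvalueP; exists (w *m F) => //.
by rewrite -mulmxA FS scalemxAr.
Qed.

End CayleySpectrum.

(** * A permutation model, bounding the order from below *)

Section T8nModel.
Variables (n : nat) (n_gt0 : (0 < n)%N).

(* Left multiplication by a and by b on normal forms, a^r b^(s0 + 2 s1) being
   encoded as (r, (s0, s1)). *)
Definition modelA (x : 'Z_(2 * n) * (bool * bool)) := (x.1 + 1, x.2).
Definition modelB (x : 'Z_(2 * n) * (bool * bool)) :=
  match x with
  | (r, (false, s1)) => (- r, (true, s1))
  | (r, (true, false)) => (- r, (false, true))
  | (r, (true, true)) => (n%:R - r, (false, false))
  end.

Lemma model_2n : (2 * n)%:R = 0 :> 'Z_(2 * n).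
Proof. by apply/val_inj; rewrite /= val_Zp_nat ?modnn; lia. Qed.

Lemma model_opp_n : - n%:R = n%:R :> 'Z_(2 * n).
Proof. by apply/eqP; rewrite eq_sym -addr_eq0 -natrD addnn -mul2n model_2n. Qed.

Lemma modelA_inj : injective modelA.
Proof.
move=> [r s] [r' s'] /eqP; rewrite xpair_eqE (inj_eq (addIr _)).
by move=> /andP[] /= /eqP-> /eqP->.
Qed.

Lemma modelB_inj : injective modelB.
Proof.
by move=> [r [[] []]] [r' [[] []]] //= /eqP;
  rewrite !xpair_eqE /= ?andbT ?andbF // ?(inj_eq (addrI _)) eqr_opp => /eqP->.
Qed.

Let A := perm modelA_inj.
Let B := perm modelB_inj.

Lemma modelA_exp k r s : (A ^+ k)%g (r, s) = (r + k%:R, s).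
Proof.
elim: k r => [|k IHk] r; first by rewrite expg0 perm1 addr0.
by rewrite expgS permM permE IHk /= -addrA -mulrS.
Qed.

Lemma modelB_exp4 r s : (B ^+ 4)%g (r, s) = (r + n%:R, s).
Proof.
rewrite !expgS expg0 mulg1 !permM !permE.
by case: s => [[] []] /=; rewrite ?opprB ?opprD ?opprK ?model_opp_n // addrC.
Qed.

(** By the presentation, the group maps onto any group whose generators satisfy the relations. [A]
    and [B] do, and the orbit of the encoded identity is the whole model, of size 8n. *)
Lemma T8n_card_ge (gT : finGroupType) (a b : gT) : is_T8n n a b -> (8 * n <= #|gT|)%N.
Proof.
case=> presT _ _ _ _.
pose H := <<[set A; B]>>%G.
have An : (A ^+ n = B ^+ 4)%g.
  by apply/permP => [[r s]]; rewrite modelA_exp modelB_exp4.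
have A2n : (A ^+ (2 * n) = 1)%g.
  by apply/permP => [[r s]]; rewrite modelA_exp perm1 model_2n addr0.
have HT : H \homg Grp (x : y : x ^+ (2 * n), y ^+ 8, x ^+ n = y ^+ 4, x ^ y = x^-1).
  apply/existsP; exists (A, B); rewrite /= !xpair_eqE /=.
  rewrite joing_idl joing_idr eqxx /= A2n eqxx /=.
  rewrite (_ : B ^+ 8 = 1)%g ?An ?eqxx /=; last first.
    by rewrite (expgM B 4 2) -An expgAC -expgM A2n.
  (* The conjugation relation is verified pointwise as A B A = B. *)
  rewrite conjgE -(inj_eq (mulgI B)) mulKVg.
  rewrite -(inj_eq (mulIg A)) mulgKV; apply/eqP/permP => [[r [[] []]]];
    rewrite !permM !permE /= /modelA /= ?opprD -?addrA ?addNr ?addr0 //.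

rewrite -presT in HT; rewrite -cardsT; apply: leq_trans (leq_homg HT).
pose f (h : {perm _}) := h (0 : 'Z_(2 * n), (false, false)).
apply: leq_trans (leq_imset_card f H).
have -> : (8 * n)%N = #|{: 'Z_(2 * n) * (bool * bool)}|.
  by rewrite !card_prod !card_bool card_ord Zp_cast; lia.
rewrite -cardsT; apply/subset_leq_card/subsetP => [[r [s0 s1]] _].
have AH : A \in H by rewrite mem_gen // !inE eqxx.
have BH : B \in H by rewrite mem_gen // !inE eqxx orbT.
(* Permutations compose from left to right, so the power of [B] acts first. *)
apply/imsetP; exists (B ^+ (s0 + 2 * s1) * A ^+ r)%g; first by rewrite groupM ?groupX.
rewrite /f permM; have -> : (B ^+ (s0 + 2 * s1))%g (0, (false, false)) = (0, (s0, s1)).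
  by case: s0 s1 => [] []; rewrite /= !(expgS, expg0) ?(permM, permE, perm1) /= ?oppr0.
by rewrite modelA_exp add0r natr_Zp.
Qed.
End T8nModel.

(** * Normal forms and their exponents *)

Section NormalForm.
Variables (n : nat) (n_gt0 : (0 < n)%N) (gT : finGroupType) (a b : gT).
Hypothesis T8n_ab : is_T8n n a b.

Lemma T8n_a2n : (a ^+ (2 * n) = 1)%g. Proof. by case: T8n_ab => _ _ []. Qed.

Lemma T8n_an : (a ^+ n = b ^+ 4)%g. Proof. by case: T8n_ab. Qed.

Lemma T8n_conj : (a ^ b = a^-1)%g. Proof. by case: T8n_ab => _ _ _ _; rewrite conjgE mulgA. Qed.

Lemma T8n_a_mod r : (a ^+ (r %% (2 * n)) = a ^+ r)%g.
Proof. exact: expg_mod T8n_a2n. Qed.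

Lemma T8n_norm r s :
  (a ^+ r * b ^+ s = a ^+ ((r + n * (s %/ 4)) %% (2 * n)) * b ^+ (s %% 4))%g.
Proof.
rewrite T8n_a_mod expgD expgM T8n_an -expgM -mulgA -expgD mulnC.
by rewrite -divn_eq.
Qed.

Lemma T8n_form x :
  exists p : 'I_(2 * n) * 'I_4, x = (a ^+ p.1 * b ^+ p.2)%g.
Proof.
have : x \in (<[a]> * <[b]>)%g.
  rewrite -norm_joinEr; last first.
    by rewrite cycle_subG inE -cycleJ T8n_conj cycleV.
  suff -> : (<[a]> <*> <[b]> = [set: gT])%g by rewrite inE.
  by rewrite joing_idl joing_idr; case: T8n_ab.
case/mulsgP => _ _ /cycleP[r ->] /cycleP[s ->] ->.
have n2 : (0 < 2 * n)%N by lia.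
exists (Ordinal (ltn_pmod (r + n * (s %/ 4)) n2), Ordinal (ltn_pmod s (isT : 0 < 4)%N)).
exact: T8n_norm.
Qed.

(** By counting: the 8n normal forms exhaust a group of order at least 8n. *)
Lemma T8n_form_inj :
  injective (fun p : 'I_(2 * n) * 'I_4 => (a ^+ p.1 * b ^+ p.2)%g).
Proof.
set f := fun p => _.
suff /image_injP fi : #|image f predT| == #|{: 'I_(2 * n) * 'I_4}|.
  by move=> p q; apply: fi.
rewrite eqn_leq leq_image_card /= card_prod !card_ord.
rewrite -(eq_card (_ : predT =i image f predT)).
  by apply: leq_trans (T8n_card_ge n_gt0 T8n_ab); lia.
by move=> x; have [p ->] := T8n_form x; rewrite (image_f f).
Qed.

Lemma T8n_expE r s : (r < 2 * n)%N -> (s < 4)%N ->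
  T8n_exp n a b (a ^+ r * b ^+ s)%g = (r, s).
Proof.
move=> lt_r lt_s; rewrite /T8n_exp; case: pickP => [p /eqP|].
  by move/(T8n_form_inj (x1 := (Ordinal lt_r, Ordinal lt_s))) => <-.
by move/(_ (Ordinal lt_r, Ordinal lt_s)); rewrite /= eqxx.
Qed.

Lemma T8n_exp_norm r s :
  T8n_exp n a b (a ^+ r * b ^+ s)%g = ((r + n * (s %/ 4)) %% (2 * n), s %% 4)%N.
Proof. by rewrite T8n_norm T8n_expE ?ltn_pmod //; lia. Qed.

Variant T8n_spec : gT -> nat * nat -> Prop :=
  T8nSpec r s of (r < 2 * n)%N & (s < 4)%N : T8n_spec (a ^+ r * b ^+ s)%g (r, s).

Lemma T8n_expP x : T8n_spec x (T8n_exp n a b x).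
Proof.
by have [[r s] ->] := T8n_form x; rewrite T8n_expE ?ltn_ord //.
Qed.

(** Exponents are natural numbers, so a^-r is written with exponent (2n - 1) r, as on the matrix
    side in [repBA]. *)
Lemma T8n_mul_b r s : (b * (a ^+ r * b ^+ s) = a ^+ ((2 * n).-1 * r) * b ^+ s.+1)%g.
Proof.
have bar : (b * a ^+ r = a ^- r * b)%g.
  by rewrite [RHS]conjgC -expgVn conjXg conjVg T8n_conj invgK.
have -> : (a ^+ ((2 * n).-1 * r) = a ^- r)%g.
  apply/eqP; rewrite eq_sym eq_invg_mul -expgD -mulSn prednK; last lia.
  by rewrite expgM T8n_a2n expg1n.
by rewrite mulgA bar -!mulgA -expgS.
Qed.

End NormalForm.

(** * Two-by-two matrices *)

Lemma ord2P (i : 'I_2) : {i = 0} + {i = 1}.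
Proof. by case: i => [[|[|//]] lti]; [left | right]; apply/val_inj. Qed.

Definition mk2 (F : fieldType) (p q r s : F) : 'M[F]_2 :=
  \matrix_(i, j) if i == 0 then if j == 0 then p else q else if j == 0 then r else s.

Section Mk2.
Variable F : fieldType.
Implicit Types (p q r s : F) (M : 'M[F]_2).

Lemma mk2_eta M : M = mk2 (M 0 0) (M 0 1) (M 1 0) (M 1 1).
Proof.
apply/matrixP => i j; rewrite mxE.
by have [->|->] := ord2P i; have [->|->] := ord2P j.
Qed.

Lemma mk2M p q r s p' q' r' s' :
  mk2 p q r s * mk2 p' q' r' s' =
  mk2 (p * p' + q * r') (p * q' + q * s') (r * p' + s * r') (r * q' + s * s').
Proof.
by apply/matrixP => i j; rewrite !mxE !big_ord_recl big_ord0 addr0 !mxE /=;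
  have [->|->] := ord2P i; have [->|->] := ord2P j.
Qed.

Lemma mk2_tr p q r s : \tr (mk2 p q r s) = p + s.
Proof. by rewrite /mxtrace !big_ord_recl big_ord0 addr0 !mxE. Qed.

Lemma mk2_1 : mk2 1 0 0 1 = 1 :> 'M[F]_2.
Proof.
by apply/matrixP => i j; rewrite !mxE; have [->|->] := ord2P i; have [->|->] := ord2P j.
Qed.

Lemma mk2_diagX p s k : mk2 p 0 0 s ^+ k = mk2 (p ^+ k) 0 0 (s ^+ k).
Proof.
elim: k => [|k IHk]; first by rewrite !expr0 mk2_1.
by rewrite exprS IHk mk2M !exprS !(mul0r, mulr0, addr0, add0r).
Qed.

Lemma row2P (v w : 'rV[F]_2) : v 0 0 = w 0 0 -> v 0 1 = w 0 1 -> v = w.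
Proof. by move=> v0 v1; apply/rowP => j; have [->|->] := ord2P j. Qed.

(** Combining the two coordinate equations shows that (z - p)^2 - q r kills both coordinates of an
    eigenvector. Conversely (r, z - p) is an eigenvector, unless r = 0, when z = p and (0, 1)
    serves. *)
Lemma mk2_eigenvalueP p q r z :
  reflect ((z - p) ^+ 2 = q * r) (eigenvalue (mk2 p q r p) z).
Proof.
have mulE (v : 'rV[F]_2) : 
    ((v *m mk2 p q r p) 0 0 = v 0 0 * p + v 0 1 * r)
  * ((v *m mk2 p q r p) 0 1 = v 0 0 * q + v 0 1 * p).
  have l1 : lift ord0 ord0 = 1 :> 'I_2 by apply/val_inj.
  by split; rewrite !mxE !big_ord_recl big_ord0 !addr0 !mxE /= l1.
apply: (iffP eigenvalueP) => [[v vM v0]|zE].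
  have e0 := congr1 (fun w : 'rV_2 => w 0 0) vM.
  have e1 := congr1 (fun w : 'rV_2 => w 0 1) vM.
  rewrite /= mulE mxE in e0; rewrite /= mulE mxE in e1.
  have h0 : ((z - p) ^+ 2 - q * r) * v 0 0 = 0.
    transitivity ((z - p) * (z * v 0 0 - (v 0 0 * p + v 0 1 * r))
                  + r * (z * v 0 1 - (v 0 0 * q + v 0 1 * p))); first ring.
    by rewrite e0 e1 !subrr !mulr0 addr0.
  have h1 : ((z - p) ^+ 2 - q * r) * v 0 1 = 0.
    transitivity ((z - p) * (z * v 0 1 - (v 0 0 * q + v 0 1 * p))
                  + q * (z * v 0 0 - (v 0 0 * p + v 0 1 * r))); first ring.
    by rewrite e0 e1 !subrr !mulr0 addr0.
  apply/eqP; rewrite -subr_eq0; apply: contraNT v0 => zp.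
  move/eqP: h0; move/eqP: h1; rewrite !mulf_eq0 (negPf zp) /= => /eqP v1 /eqP v0.
  by apply/eqP/row2P; rewrite mxE.
pose v w0 w1 : 'rV[F]_2 := \row_j if j == 0 then w0 else w1.
have vE w0 w1 : (v w0 w1 0 0 = w0) * (v w0 w1 0 1 = w1) by rewrite !mxE.
have vN0 w0 w1 : v w0 w1 = 0 -> w0 = 0 /\ w1 = 0.
  by move=> v0; split; [rewrite -(vE w0 w1).1 | rewrite -(vE w0 w1).2]; rewrite v0 mxE.
have [r0|r0] := eqVneq r 0.
  have zp : z = p by apply/eqP; rewrite -subr_eq0 -[_ == 0](expf_eq0 _ 2) zE r0 mulr0.
  exists (v 0 1); last by apply/eqP => /vN0[_ /eqP]; rewrite oner_eq0.
  by apply: row2P; rewrite mulE [RHS]mxE !vE zp ?r0; ring.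
exists (v r (z - p)); last by apply/eqP => /vN0[/eqP]; rewrite (negPf r0).
apply: row2P; rewrite mulE [RHS]mxE !vE; first ring.
by rewrite [r * q]mulrC -zE; ring.
Qed.

End Mk2.

(** * The two-dimensional representations *)

Definition repA (l : algC) := mk2 l 0 0 l^-1.
Definition repB (c : algC) := mk2 0 c 1 0.

Definition rep2 n (gT : finGroupType) (a b : gT) (l c : algC) (x : gT) : 'M[algC]_2 :=
  let: (r, s) := T8n_exp n a b x in repA l ^+ r * repB c ^+ s.

Section TwoDimRep.
Variables (n : nat) (n_gt0 : (0 < n)%N) (gT : finGroupType) (a b : gT).
Hypothesis T8n_ab : is_T8n n a b.
Variables (l c : algC).
Hypotheses (l2n : l ^+ (2 * n) = 1) (c2 : c ^+ 2 = l ^+ n).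

Let rho := rep2 n a b l c.

Lemma repB2 : repB c ^+ 2 = mk2 c 0 0 c.
Proof. by rewrite expr2 mk2M !(mul0r, mulr0, addr0, add0r, mul1r, mulr1). Qed.

Lemma repl_neq0 : l != 0.
Proof.
apply: contraPneq l2n => ->; apply/eqP.
by rewrite expr0n; case: n n_gt0 => // k _; rewrite mulnS /= eq_sym oner_eq0.
Qed.

Lemma repl_inv k : l ^- k = l ^+ ((2 * n).-1 * k).
Proof.
have l0 := repl_neq0; apply: (mulfI (expf_neq0 k l0)); rewrite mulfV ?expf_neq0 //.
by rewrite -exprD -mulSn prednK ?(exprM _ (2 * n)) ?l2n ?expr1n //; lia.
Qed.

Lemma repl_invn : l ^- n = l ^+ n.
Proof.
have l0 := repl_neq0; apply: (mulfI (expf_neq0 n l0)).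
by rewrite mulfV ?expf_neq0 // -exprD addnn -mul2n l2n.
Qed.

Lemma repB_exp4 : repB c ^+ 4 = repA l ^+ n.
Proof. by rewrite (exprM _ 2 2) repB2 !mk2_diagX c2 exprVn repl_invn. Qed.

Lemma repA_2n : repA l ^+ (2 * n) = 1.
Proof. by rewrite mk2_diagX exprVn l2n invr1 mk2_1. Qed.

Lemma repA_mod r : repA l ^+ (r %% (2 * n)) = repA l ^+ r.
Proof. exact: expr_mod repA_2n. Qed.

(** [rep2] is defined through reduced exponents; the matrices satisfy A^(2n) = 1 and B^4 = A^n, so
    the reduction can be undone. *)
Lemma rep2_form r s : rho (a ^+ r * b ^+ s)%g = repA l ^+ r * repB c ^+ s.
Proof.
rewrite /rho /rep2 T8n_exp_norm // repA_mod exprD -mulrA.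
by rewrite exprM -repB_exp4 -exprM -exprD mulnC -divn_eq.
Qed.

Lemma repBA r : repB c * repA l ^+ r = repA l ^+ ((2 * n).-1 * r) * repB c.
Proof.
rewrite !mk2_diagX !exprVn !mk2M -!repl_inv invrK.
by rewrite !(mul0r, mulr0, addr0, add0r, mul1r, mulr1) mulrC.
Qed.

Lemma rep2_1 : rho 1%g = 1%:M.
Proof. by have := rep2_form 0 0; rewrite !expg0 mulg1 !expr0 mulr1. Qed.

(** It suffices to treat left multiplication by [a] and by [b], whose effect on normal forms is
    known, and to propagate along a^r b^s. *)
Lemma rep2_M : {morph rho : x y / (x * y)%g >-> x *m y}.
Proof.
have rho_a y : rho (a * y)%g = repA l * rho y.
  case: (T8n_expP n_gt0 T8n_ab y) => r s _ _.
  by rewrite mulgA -expgS !rep2_form exprS mulrA.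
have rho_b y : rho (b * y)%g = repB c * rho y.
  case: (T8n_expP n_gt0 T8n_ab y) => r s _ _.
  by rewrite (T8n_mul_b n_gt0 T8n_ab) !rep2_form exprS mulrA -repBA mulrA.
move=> x y; case: (T8n_expP n_gt0 T8n_ab x) => r s _ _.
rewrite rep2_form -[RHS]/(_ * _) -mulgA.
have rho_bs : rho (b ^+ s * y)%g = repB c ^+ s * rho y.
  elim: s => [|s IHs]; first by rewrite expg0 mul1g expr0 mul1r.
  by rewrite expgS -mulgA rho_b IHs exprS mulrA.
rewrite -mulrA -rho_bs; elim: r => [|r IHr]; first by rewrite expg0 mul1g expr0 mul1r.
by rewrite expgS -mulgA rho_a IHr exprS !mulrA.
Qed.

Lemma rep2_formE r s : (s < 4)%N ->
  rho (a ^+ r * b ^+ s)%g = match s with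
    | 0 => mk2 (l ^+ r) 0 0 (l ^- r)
    | 1 => mk2 0 (c * l ^+ r) (l ^- r) 0
    | 2 => mk2 (c * l ^+ r) 0 0 (c * l ^- r)
    | _ => mk2 0 (c ^+ 2 * l ^+ r) (c * l ^- r) 0
    end.
Proof.
rewrite rep2_form mk2_diagX exprVn => lt_s.
case: s lt_s => [|[|[|[|//]]]] _.
- by rewrite mulr1.
- by rewrite expr1 mk2M !(mul0r, mulr0, addr0, add0r, mulr1) mulrC.
- by rewrite repB2 mk2M !(mul0r, mulr0, addr0, add0r) ![_ * c]mulrC.
- rewrite exprS repB2 !mk2M !(mul0r, mulr0, addr0, add0r, mul1r, mulr1).
  by rewrite -expr2 [_ ^+ r * _]mulrC [l ^- r * _]mulrC.
Qed.

Lemma rep2_trE r s : (s < 4)%N ->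
  \tr (rho (a ^+ r * b ^+ s)%g) = match s with
    | 0 => l ^+ r + l ^- r
    | 2 => c * (l ^+ r + l ^- r)
    | _ => 0
    end.
Proof.
move=> lt_s; rewrite rep2_formE //.
by case: s lt_s => [|[|[|[|//]]]] _; rewrite mk2_tr ?addr0 // mulrDr.
Qed.

End TwoDimRep.

(** * Completeness of these representations *)

Lemma unity_sum_eq0 N (F : nat -> algC) :
    (forall l : algC, l ^+ N = 1 -> \sum_(r < N) F r * l ^+ r = 0) ->
  forall r, (r < N)%N -> F r = 0.
Proof.
move=> F0 r lt_r; have N0 : (0 < N)%N by apply: leq_ltn_trans lt_r.
have [z z_N] := C_prim_root_exists N0.
(* A polynomial of size at most N vanishing at the N distinct powers of [z] is zero. *)
pose p := \poly_(i < N) F i.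
suff p0 : p = 0 by have := coef_poly N F r; rewrite -/p p0 coef0 lt_r.
apply/eqP; apply: contraT => /max_poly_roots.
move/(_ [seq z ^+ i | i <- iota 0 N]); rewrite size_map size_iota ltnNge size_poly.
apply.
  apply/allP => _ /mapP[i _ ->]; rewrite rootE horner_poly F0 //.
  by rewrite exprAC (prim_expr_order z_N) expr1n.
rewrite map_inj_in_uniq ?iota_uniq // => i j; rewrite !mem_iota /= => lt_i lt_j /eqP.
by rewrite (eq_prim_root_expr z_N) !modn_small // => /eqP.
Qed.

Section Completeness.
Variables (n : nat) (n_gt0 : (0 < n)%N) (gT : finGroupType) (a b : gT).
Hypothesis T8n_ab : is_T8n n a b.

Lemma T8n_sum (V : nmodType) (F : gT -> V) :
  \sum_x F x = \sum_(r < 2 * n) \sum_(s < 4) F (a ^+ r * b ^+ s)%g.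
Proof.
pose f (p : 'I_(2 * n) * 'I_4) := (a ^+ p.1 * b ^+ p.2)%g.
rewrite pair_big /= (reindex f) //=.
apply: onW_bij; apply: inj_card_bij; first exact: (T8n_form_inj n_gt0 T8n_ab).
apply: leq_trans (leq_image_card f predT).
apply/subset_leq_card/subsetP => x _.
by have [p ->] := T8n_form n_gt0 T8n_ab x; rewrite (image_f f).
Qed.

(** Entry (0, 0) sees only s = 0 and s = 2, entry (1, 0) only s = 1 and s = 3. The two signs of c
    separate the two values of s, then the roots of unity l separate r. *)
Lemma rep2_complete (f : gT -> algC) :
    (forall l c, l ^+ (2 * n) = 1 -> c ^+ 2 = l ^+ n ->
       \sum_x f x *: rep2 n a b l c x = 0) ->
  forall x, f x = 0.
Proof.
move=> f0.
pose F s r := f (a ^+ r * b ^+ s)%g.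
(* Both square roots c and - c of l ^+ n are available. *)
have two_sol (g h : nat -> algC) :
    (forall l c, l ^+ (2 * n) = 1 -> c ^+ 2 = l ^+ n ->
       \sum_(r < 2 * n) (g r + c * h r) * l ^+ r = 0) ->
    forall r, (r < 2 * n)%N -> g r = 0 /\ h r = 0.
  move=> gh0.
  have gh l c : l ^+ (2 * n) = 1 -> c ^+ 2 = l ^+ n ->
      \sum_(r < 2 * n) g r * l ^+ r + c * (\sum_(r < 2 * n) h r * l ^+ r) = 0.
    move=> l2n c2; rewrite -[RHS](gh0 l c l2n c2) mulr_sumr -big_split /=.
    by apply: eq_bigr => r _; rewrite mulrDl mulrA.
  have gh2 l : l ^+ (2 * n) = 1 ->
      \sum_(r < 2 * n) g r * l ^+ r = 0 /\ \sum_(r < 2 * n) h r * l ^+ r = 0.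
    move=> l2n; have c2 := sqrtCK (l ^+ n); set c := sqrtC _ in c2.
    have Nc2 : (- c) ^+ 2 = l ^+ n by rewrite sqrrN.
    have c0 : c != 0.
      rewrite sqrtC_eq0 expf_neq0 //; apply: contra_eq_neq l2n => ->.
      by rewrite expr0n muln_eq0 /= gtn_eqF // eq_sym oner_eq0.
    have := gh _ _ l2n c2; have := gh _ _ l2n Nc2.
    set X := \sum_r _; set Y := \sum_r _ => h1 h2.
    have X0 : X = 0.
      apply: (mulfI (_ : (2 : algC) != 0)); first by rewrite pnatr_eq0.
      by transitivity ((X + - c * Y) + (X + c * Y)); [ring | rewrite h1 h2; ring].
    by split=> //; apply: (mulfI c0); rewrite -[LHS]add0r -{1}X0 h2 mulr0.
  move=> r lt_r; split.
    by apply: unity_sum_eq0 lt_r => l /gh2[].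
  by apply: unity_sum_eq0 lt_r => l /gh2[].
have entry l c (i j : 'I_2) : l ^+ (2 * n) = 1 -> c ^+ 2 = l ^+ n ->
    \sum_(r < 2 * n) \sum_(s < 4) F s r * rep2 n a b l c (a ^+ r * b ^+ s)%g i j = 0.
  move=> l2n c2; have := congr1 (fun M : 'M_2 => M i j) (f0 l c l2n c2).
  rewrite T8n_sum mxE summxE => h; rewrite -[RHS]h; apply: eq_bigr => r _.
  by rewrite summxE; apply: eq_bigr => s _; rewrite mxE.
have even_s : forall r, (r < 2 * n)%N -> F 0 r = 0 /\ F 2 r = 0.
  apply: two_sol => l c l2n c2; rewrite -[RHS](entry l c 0 0 l2n c2).
  apply: eq_bigr => r _; rewrite !big_ord_recl big_ord0 !rep2_formE //= !mxE /=; ring.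
have odd_s : forall r, (r < 2 * n)%N -> F 1 r = 0 /\ F 3 r = 0.
  apply: two_sol => l c l2n c2.
  (* Entry (1, 0) carries l^-r, so the hypothesis is used at l^-1 to obtain powers of l. *)
  have Vl2n : l^-1 ^+ (2 * n) = 1 by rewrite exprVn l2n invr1.
  have Vc2 : c ^+ 2 = l^-1 ^+ n by rewrite exprVn repl_invn.
  rewrite -[RHS](entry l^-1 c 1 0 Vl2n Vc2).
  apply: eq_bigr => r _; rewrite !big_ord_recl big_ord0 !rep2_formE //= !mxE /= exprVn invrK; ring.
move=> x; have [[r s] ->] := T8n_form n_gt0 T8n_ab x; rewrite /=.
have [F0 F2] := even_s r (ltn_ord r); have [F1 F3] := odd_s r (ltn_ord r).
by case: s => [[|[|[|[|//]]]]] /= _.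
Qed.

End Completeness.

(** * Sets closed under change of generator *)

Section GeneratorClosed.
Variables (gT : finGroupType) (G : {group gT}).

Lemma in_B_bigU (I : finType) (P : pred I) (A : I -> {set gT}) :
  (forall i, P i -> in_B G (A i)) -> in_B G (\bigcup_(i | P i) A i).
Proof.
move=> BA; elim/big_ind: _ => //; last by move=> X Y; apply: in_B_setU.
by rewrite -(setDv G); apply/in_B_setC/in_B_subgroup.
Qed.

Lemma generator_closed_in_B (A : {set gT}) :
    A \subset G ->
    (forall x y, x \in A -> <[y]>%g = <[x]>%g -> y \in A) ->
  in_B G A.
Proof.
move=> sAG genA.
(* The generators of <[x]> are what remains after removing its proper cyclic subgroups; [A] is a
   union of such classes. *)
pose gens x := (<[x]> :&: (G :\: \bigcup_(y | (y \in <[x]>) && (<[y]> != <[x]>)) <[y]>))%g.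
have -> : A = \bigcup_(x in A) gens x.
  apply/setP/subset_eqP/andP; split; apply/subsetP => x.
    move=> xA; apply/bigcupP; exists x; rewrite // !inE cycle_id (subsetP sAG) // andbT.
    apply/bigcupP => -[y /andP[yx nyx] xy]; case/negP: nyx.
    by rewrite eqEsubset !cycle_subG yx.
  case/bigcupP => y yA; rewrite !inE => /and3P[xy + _].
  apply: contraNT => xA; apply/bigcupP; exists x; rewrite ?cycle_id // xy /=.
  by apply: contraNneq xA; apply: genA.
have cycG x : x \in G -> in_B G <[x]>%g by move=> xG; apply: in_B_subgroup; rewrite cycle_subG.
apply: in_B_bigU => x /(subsetP sAG) xG; apply: in_B_setI; first exact: cycG.
apply: in_B_setC; apply: in_B_bigU => y /andP[yx _]; apply: cycG.
by apply: subsetP yx; rewrite cycle_subG.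
Qed.

End GeneratorClosed.

(** * Galois conjugation and rational sums *)

Section RationalSums.
Variables (n : nat) (n_gt0 : (0 < n)%N) (gT : finGroupType) (a b : gT).
Hypothesis T8n_ab : is_T8n n a b.

Let ex x := (T8n_exp n a b x).1.

Lemma T8n_exp_a r : T8n_exp n a b (a ^+ r)%g = (r %% (2 * n), 0)%N.
Proof. by have := T8n_exp_norm n_gt0 T8n_ab r 0; rewrite mulg1 muln0 addn0. Qed.

Lemma T8n_exp_cycle x : x \in <[a]>%g -> x = (a ^+ ex x)%g.
Proof.
by case/cycleP => r ->; rewrite /ex T8n_exp_a (T8n_a_mod T8n_ab).
Qed.

Lemma T8n_a_exp1 r : (a ^+ r = 1)%g -> (2 * n %| r)%N.
Proof.
move=> ar; have := T8n_exp_a r.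
by rewrite ar -(expg0 a) T8n_exp_a mod0n => -[] /esym/eqP.
Qed.

(* Galois: the automorphism raising the #[x]-th roots of unity to the power u
   acts on all (2n)-th roots of unity as some power v, and fixes every
   character sum over A; hence x |-> x ^+ v preserves A as a multiset. *)
Lemma rational_generator_closed (A : {set gT}) :
    A \subset <[a]>%g ->
    (forall l, l ^+ (2 * n) = 1 -> \sum_(x in A) l ^+ ex x \in Crat) ->
  forall x y, x \in A -> <[y]>%g = <[x]>%g -> y \in A.
Proof.
move=> sAa ratA x y xA /esym/eqP; rewrite -/(generator _ _) => gen_y.
have /cycleP[u def_y] : y \in <[x]>%g by rewrite (eqP gen_y) cycle_id.
move: gen_y; rewrite def_y generator_coprime => co_u.
have [nu nuE] := @Qn_aut_exists u #[x]%g (etrans (coprime_sym _ _) co_u).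
have n2 : (0 < 2 * n)%N by lia.
have [z z_2n] := C_prim_root_exists n2.
have [v _ nu_z] := aut_prim_rootP nu z_2n.
have nu_l l : l ^+ (2 * n) = 1 -> nu l = l ^+ v.
  by case/(prim_rootP z_2n) => i ->; rewrite rmorphXn /= nu_z exprAC.
have exX w k : w \in A -> ex (w ^+ k)%g = (ex w * k %% (2 * n))%N.
  by move=> /(subsetP sAa)/T8n_exp_cycle {1}->; rewrite -expgM /ex T8n_exp_a.
(* [nu] raises [z ^+ ex x], whose order divides that of x, to the power u by choice and to the power
   v by its action on [z]. *)
have xuv : (x ^+ u = x ^+ v)%g.
  have /T8n_exp_cycle xE := subsetP sAa _ xA.
  rewrite xE -!expgM -[LHS](T8n_a_mod T8n_ab) -[RHS](T8n_a_mod T8n_ab).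
  congr (_ ^+ _)%g; apply/eqP; rewrite -(eq_prim_root_expr z_2n) !exprM; apply/eqP.
  rewrite -nuE ?rmorphXn /= ?nu_z; first by rewrite exprAC.
  apply/eqP; rewrite -exprM -(prim_order_dvd z_2n); apply: T8n_a_exp1.
  by rewrite expgM -xE expg_order.
(* The multiplicity of the exponent r among the elements of [A], minus its multiplicity among their
   v-th powers. *)
pose F r : algC := \sum_(w in A) ((ex w == r)%:R - (ex (w ^+ v)%g == r)%:R).
have ex_lt w : (ex w < 2 * n)%N.
  by rewrite /ex; case: (T8n_expP n_gt0 T8n_ab w).
have pick_l w (l : algC) : \sum_(r < 2 * n) (ex w == r)%:R * l ^+ r = l ^+ ex w.
  rewrite (bigD1 (Ordinal (ex_lt w))) //= eqxx mul1r big1 ?addr0 // => i.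
  by rewrite eq_sym -val_eqE /= => /negPf->; rewrite mul0r.
have F0 : forall r, (r < 2 * n)%N -> F r = 0.
  apply: unity_sum_eq0 => l l2n; under eq_bigr do rewrite mulr_suml.
  rewrite exchange_big /=; under eq_bigr do under eq_bigr do rewrite mulrBl.
  under eq_bigr do rewrite sumrB !pick_l.
  rewrite sumrB; apply/eqP; rewrite subr_eq0; apply/eqP.
  have /(aut_Crat nu) <- := ratA l l2n.
  rewrite rmorph_sum /=; apply: eq_bigr => w wA.
  by rewrite rmorphXn /= nu_l // exX // expr_mod // -exprM mulnC.
have /eqP := F0 _ (ex_lt (x ^+ v)%g); rewrite /F sumrB subr_eq0 => /eqP sumE.
(* The element x contributes to the second count, so the first is nonzero too: some w in [A] has the
   exponent of x ^+ v. *)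
have : \sum_(w in A) (ex w == ex (x ^+ v)%g)%:R != 0 :> algC.
  rewrite sumE (bigD1 x) //= eqxx paddr_eq0 ?ler01 ?sumr_ge0 //.
  by rewrite oner_eq0.
rewrite -natr_sum pnatr_eq0 sum_nat_eq0 negb_forall_in => /exists_inP[w wA].
rewrite eqb0 negbK => /eqP exw.
have -> : (x ^+ u)%g = w; last by [].
rewrite xuv (T8n_exp_cycle (subsetP sAa _ wA)) exw -T8n_exp_cycle //.
by rewrite groupX // (subsetP sAa).
Qed.

End RationalSums.

(** * Parameters of the given characters *)

Definition chi_l n j : algC := if odd n then (-1) ^+ j else if odd j then -1 else 1.
Definition chi_b n j : algC := omega ^+ (if odd n || ~~ odd j then j else j.-1).
(** The l and c at which [rep2] has trace phi_k; [psi_l] and [psi_c] do the same for psi_h, the sign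
    in [psi_l] absorbing (-1)^(rh+r). *)
Definition phi_l n k : algC := if odd n then eps n ^+ k else xi n ^+ k.
Definition phi_c n k : algC := if odd n then (-1) ^+ k else if odd k then 'i else 1.
Definition psi_l n h : algC := if odd n then (-1) ^+ h.+1 * xi n ^+ h else xi n ^+ h.
Definition psi_c n h : algC := if odd n then 'i else if odd h then - 'i else -1.

Lemma signr_eq (R : pzRingType) i j : odd i = odd j -> (-1) ^+ i = (-1) ^+ j :> R.
Proof. by move=> e; rewrite -signr_odd e signr_odd. Qed.

Lemma omega_prim : 8.-primitive_root omega.
Proof. exact: (rootCN1_prim (isT : 0 < 4)%N). Qed.

Lemma omega4 : omega ^+ 4 = -1.
Proof. exact: rootCK. Qed.

Lemma chi_valE n j r s : chi_val n j r s = chi_l n j ^+ r * chi_b n j ^+ s.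
Proof.
rewrite /chi_val /chi_l /chi_b; case: ifP => _ /=; first by rewrite -!exprM ![(j * _)%N]mulnC.
by case: ifP => _ /=; rewrite -exprM mulnC ?expr1n ?mul1r.
Qed.

Lemma chi_l_sqr n j : chi_l n j ^+ 2 = 1.
Proof. by rewrite /chi_l; do 2?case: ifP => _; rewrite ?sqrr_sign ?sqrrN ?expr1n. Qed.

Lemma chi_b_exp4 n j : chi_b n j ^+ 4 = chi_l n j ^+ n.
Proof.
rewrite /chi_b exprAC omega4 /chi_l; case odd_n: (odd n) => /=.
  by rewrite -exprM; apply: signr_eq; rewrite oddM odd_n andbT.
case odd_j: (odd j) => /=; rewrite -signr_odd ?odd_j.
  by rewrite -[in RHS]signr_odd odd_n; case: j odd_j => //= j /negPf ->.
by rewrite expr1n.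
Qed.

(** Here beta is an eighth root of unity omega^j. For n odd, l = beta^4 = (-1)^j. For n even, beta^4
    = 1 forces j even, and the sign of l chooses between j and j + 1. *)
Lemma chi_surj n l beta : l ^+ 2 = 1 -> beta ^+ 4 = l ^+ n ->
  exists2 j, (j <= 7)%N & l = chi_l n j /\ beta = chi_b n j.
Proof.
move=> l2 beta4.
have beta8 : beta ^+ 8 = 1 by rewrite (exprM _ 4 2) beta4 exprAC l2 expr1n.
have [[j lt_j] /= betaE] := prim_rootP omega_prim beta8.
have beta4E : beta ^+ 4 = (-1) ^+ j by rewrite betaE exprAC omega4.
have ln : l ^+ n = l ^+ odd n.
  by rewrite -[n in LHS]odd_double_half exprD -mul2n exprM l2 expr1n mulr1.
rewrite /chi_l /chi_b; move: ln; case: (odd n) => /= ln.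
  by exists j; rewrite // -beta4E beta4 ln expr1.
have even_j : ~~ odd j.
  have := beta4E; rewrite beta4 ln expr0 -signr_odd; case: (odd j) => // /esym/eqP.
  by rewrite eqNr oner_eq0.
have /orP[] : (l == 1) || (l == -1) by rewrite -sqrf_eq1 l2.
  by move=> /eqP l1; exists j; rewrite // even_j (negPf even_j).
move=> /eqP lN1; exists j.+1; last by rewrite /= negbK (negPf even_j) lN1.
rewrite ltn_neqAle -ltnS lt_j andbT.
by apply: contraNneq even_j => ->.
Qed.

(** * Which representations the characters phi and psi reach *)

Section XiPowers.
Variables (n : nat) (n_gt0 : (0 < n)%N).

Lemma xi_prim : (2 * n)%N.-primitive_root (xi n).
Proof. exact: rootCN1_prim. Qed.

Lemma xi_n : xi n ^+ n = -1.
Proof. exact: rootCK. Qed.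

Lemma phi_valE k r s : (s < 4)%N -> phi_val n k r s =
  match s with
  | 0 => phi_l n k ^+ r + phi_l n k ^- r
  | 2 => phi_c n k * (phi_l n k ^+ r + phi_l n k ^- r)
  | _ => 0
  end.
Proof.
rewrite /phi_val /phi_l /phi_c; case: ifP => _; rewrite -!exprM;
  case: s => [|[|[|[|//]]]] // _.
by case: ifP; rewrite ?mul1r.
Qed.

Lemma psi_valE h r s : (s < 4)%N -> psi_val n h r s =
  match s with
  | 0 => psi_l n h ^+ r + psi_l n h ^- r
  | 2 => psi_c n h * (psi_l n h ^+ r + psi_l n h ^- r)
  | _ => 0
  end.
Proof.
rewrite /psi_val /psi_l /psi_c; case: ifP => _.
  have -> : (-1) ^+ (r * h + r) * (xi n ^+ (h * r) + xi n ^- (h * r)) =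
      ((-1) ^+ h.+1 * xi n ^+ h) ^+ r + ((-1) ^+ h.+1 * xi n ^+ h) ^- r.
    by rewrite exprMn invfM -!exprM invr_sign -mulrDr -mulnSr [(h.+1 * r)%N]mulnC.
  by case: s => [|[|[|[|//]]]].
rewrite -!exprM; case: s => [|[|[|[|//]]]] // _.
by case: ifP => _; rewrite ?mulN1r // mulNr.
Qed.

Lemma phi_l_2n k : phi_l n k ^+ (2 * n) = 1.
Proof.
have x2n := prim_expr_order xi_prim.
have e2n : eps n ^+ (2 * n) = 1 by rewrite /eps exprAC x2n expr1n.
by rewrite /phi_l; case: ifP => _; rewrite exprAC ?x2n ?e2n expr1n.
Qed.

Lemma psi_l_2n h : psi_l n h ^+ (2 * n) = 1.
Proof.
have x2n := prim_expr_order xi_prim.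
have xh : xi n ^+ h ^+ (2 * n) = 1 by rewrite exprAC x2n expr1n.
by rewrite /psi_l; case: ifP => _ //; rewrite exprMn xh mulr1 exprAC (exprM _ 2 n) sqrrN !expr1n.
Qed.

Lemma xi_exp_n e : xi n ^+ e ^+ n = (-1) ^+ e.
Proof. by rewrite exprAC xi_n. Qed.

Lemma phi_c_sqr k : phi_c n k ^+ 2 = phi_l n k ^+ n.
Proof.
rewrite /phi_c /phi_l /eps; case: ifP => _.
  by rewrite sqrr_sign -[_ ^+ 2 ^+ k]exprM xi_exp_n exprM sqrrN !expr1n.
by rewrite xi_exp_n -signr_odd; case: ifP => _; rewrite ?sqrCi // expr1n.
Qed.

Lemma psi_c_sqr h : psi_c n h ^+ 2 = psi_l n h ^+ n.
Proof.
rewrite /psi_c /psi_l; case: ifP => odd_n.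
  have sn : (-1) ^+ h.+1 ^+ n = (-1) ^+ h.+1 :> algC.
    by rewrite -exprM; apply: signr_eq; rewrite oddM odd_n andbT.
  by rewrite exprMn xi_exp_n sn sqrCi exprS -mulrA -expr2 sqrr_sign mulr1.
by rewrite xi_exp_n -signr_odd; case: ifP => _; rewrite sqrrN ?sqrCi ?expr1n.
Qed.

Lemma xi_exponent l : l ^+ (2 * n) = 1 -> l ^+ 2 != 1 ->
  exists2 e, l = xi n ^+ e & [/\ (0 < e)%N, (e < 2 * n)%N & e != n].
Proof.
move=> /(prim_rootP xi_prim)[[e lt_e] /= ->] l2; exists e => //; split=> //.
  by rewrite lt0n; apply: contraNneq l2 => ->; rewrite expr0 expr1n.
by apply: contraNneq l2 => ->; rewrite xi_n sqrrN expr1n.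
Qed.

Lemma xi_expV e : (e <= 2 * n)%N -> (xi n ^+ e)^-1 = xi n ^+ (2 * n - e).
Proof.
move=> le_e; have x0 : xi n != 0 by rewrite (prim_root_eq0 xi_prim); lia.
apply: (mulfI (expf_neq0 e x0)).
by rewrite mulfV ?expf_neq0 // -exprD subnKC // (prim_expr_order xi_prim).
Qed.

(** Inversion turns the exponent e into 2n - e, so one of the two is below n; the excluded e = 0 and
    e = n are the real values. *)
Lemma xi_upper l : l ^+ (2 * n) = 1 -> l ^+ 2 != 1 ->
  exists2 e, (1 <= e <= n.-1)%N & l = xi n ^+ e \/ l^-1 = xi n ^+ e.
Proof.
move=> l2n l2; have [e -> [e0 e2 en]] := xi_exponent l2n l2.
have [lt_e|ge_e] := ltnP e n; first by exists e; [lia | left].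
by exists (2 * n - e)%N; [lia | right; rewrite xi_expV // ltnW].
Qed.

Lemma sqr_pm (x y : algC) : x ^+ 2 = y ^+ 2 -> x = y \/ x = - y.
Proof. by move/eqP; rewrite eqf_sqr => /orP[] /eqP; auto. Qed.

(** For n even, the sign of c decides between phi and psi. For n odd, the parity of the exponent e
    of l decides: odd e gives c = 'i or - 'i, hence psi; for e = 2k one sign of c is phi_k and the
    other phi_(n-k), which inverts l and flips (-1)^k. *)
Lemma phi_psi_surj l c : l ^+ (2 * n) = 1 -> l ^+ 2 != 1 -> c ^+ 2 = l ^+ n ->
  exists2 k, (1 <= k <= n.-1)%N &
    (l = phi_l n k \/ l^-1 = phi_l n k) /\ c = phi_c n k
    \/ (l = psi_l n k \/ l^-1 = psi_l n k) /\ (c = psi_c n k \/ c^-1 = psi_c n k).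
Proof.
move=> l2n l2 c2; rewrite /phi_l /phi_c /psi_l /psi_c.
case odd_n: (odd n).
  have [e lE [e0 e2 en]] := xi_exponent l2n l2.
  have cE : c ^+ 2 = (-1) ^+ odd e by rewrite c2 lE xi_exp_n signr_odd.
  move: cE; case odd_e: (odd e) => cE.
    have {cE} ci : c = 'i \/ c^-1 = 'i.
      have /sqr_pm[->|->] : c ^+ 2 = 'i ^+ 2 by rewrite cE sqrCi.
        by left.
      by right; rewrite invrN invCi opprK.
    have [h ltn_h lh] := xi_upper l2n l2.
    have odd_h : odd h.
      have : xi n ^+ h ^+ n = -1.
        by case: lh => <-; rewrite ?exprVn lE xi_exp_n -signr_odd odd_e ?invrN1.
      by rewrite xi_exp_n -signr_odd; case: (odd h) => // /esym/eqP; rewrite eqNr oner_eq0.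
    by exists h => //; right; rewrite -signr_odd /= odd_h expr0 mul1r.
  have [k kE] : exists k, e = (2 * k)%N by exists e./2; lia.
  have {}lE : l = eps n ^+ k by rewrite lE kE exprM.
  have /sqr_pm[->|cN] : c ^+ 2 = ((-1) ^+ k) ^+ 2 by rewrite sqrr_sign cE.
    by exists k; [lia | left; split=> //; left].
  exists (n - k)%N; first lia.
  left; split; last first.
    transitivity ((-1) ^+ k.+1 : algC); first by rewrite cN exprS mulN1r.
    apply: signr_eq.
    by rewrite oddB ?odd_n //=; lia.
  by right; rewrite lE -exprM xi_expV /eps -?exprM; [congr (_ ^+ _) |]; lia.
have [k lt_k lk] := xi_upper l2n l2.
exists k => //; have {c2}: c ^+ 2 = (-1) ^+ odd k.
  rewrite c2 signr_odd; case: lk => lk; first by rewrite lk xi_exp_n.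
  by apply: invr_inj; rewrite -exprVn lk xi_exp_n invr_sign.
case: (odd k) => /=.
  rewrite expr1 -sqrCi => /sqr_pm[]->; [by left; split | by right; split=> //; left].
move=> c2'; have /sqr_pm[->|->] : c ^+ 2 = 1 ^+ 2 by rewrite c2' expr1n.
  by left; split.
by right; split=> //; left.
Qed.

End XiPowers.

(** For sums over [S1] only the phi_k are available. For n odd [phi_l] gives even powers of xi, but
    -1 = xi^n has odd exponent, so -l is reached when l is not; [tr1_opp] makes this sign
    harmless. *)
Lemma phi_l_cover n l : (0 < n)%N -> l ^+ (2 * n) = 1 -> l ^+ 2 != 1 ->
  exists2 k, (1 <= k <= n.-1)%N &
    [\/ l = phi_l n k, l^-1 = phi_l n k | - l = phi_l n k].
Proof.
move=> n_gt0 l2n l2; rewrite /phi_l; case odd_n: (odd n); last first.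
  have [k lt_k lk] := xi_upper n_gt0 l2n l2; exists k => //.
  by case: lk => lk; [constructor 1 | constructor 2].
have even_case l1 e : l1 = xi n ^+ e -> (0 < e)%N -> (e < 2 * n)%N -> ~~ odd e ->
    exists2 k, (1 <= k <= n.-1)%N & l1 = eps n ^+ k.
  move=> -> e0 e2 even_e; exists e./2; first lia.
  by rewrite -exprM; congr (_ ^+ _); lia.
have [e lE [e0 e2 en]] := xi_exponent n_gt0 l2n l2.
have [odd_e|even_e] := boolP (odd e); last first.
  by have [k lt_k lk] := even_case l e lE e0 e2 even_e; exists k => //; constructor 1.
have Nl2n : (- l) ^+ (2 * n) = 1 by rewrite exprM sqrrN -exprM.
have Nl2 : (- l) ^+ 2 != 1 by rewrite sqrrN.
have [e' l'E [e'0 e'2 _]] := xi_exponent n_gt0 Nl2n Nl2.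
have even_e' : ~~ odd e'.
  have : (-1) ^+ odd e' = 1 :> algC.
    rewrite signr_odd -(xi_exp_n n_gt0) -l'E exprNn lE xi_exp_n //.
    by rewrite (signr_eq _ (etrans odd_n (esym odd_e))) -expr2 sqrr_sign.
  by case: (odd e') => // /eqP; rewrite eqNr oner_eq0.
by have [k lt_k lk] := even_case _ e' l'E e'0 e'2 even_e'; exists k => //; constructor 3.
Qed.

(** * Traces at inverse elements and inverse parameters *)

Section CayleyT8n.
Variables (n : nat) (n_gt0 : (0 < n)%N) (gT : finGroupType) (a b : gT).
Hypothesis T8n_ab : is_T8n n a b.

Local Notation rho := (rep2 n a b).
Let ex x := (T8n_exp n a b x).1.

Section Fixed.
Variables l c : algC.
Hypotheses (l2n : l ^+ (2 * n) = 1) (c2 : c ^+ 2 = l ^+ n).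

Lemma rep2_cycle x : x \in <[a]>%g -> rho l c x = mk2 (l ^+ ex x) 0 0 (l ^- ex x).
Proof.
move=> /(T8n_exp_cycle n_gt0 T8n_ab) {1}->; rewrite -[(a ^+ _)%g]mulg1 -(expg0 b).
by rewrite rep2_formE.
Qed.

Lemma T8n_exV x : x \in <[a]>%g -> l ^+ ex x^-1%g = l ^- ex x.
Proof.
move=> xa; have Vxa : (x^-1 \in <[a]>)%g by rewrite groupV.
have := rep2_M n_gt0 T8n_ab l2n c2 x x^-1%g; rewrite mulgV rep2_1 // !rep2_cycle //.
move=> /(congr1 (fun M : 'M_2 => M 0 0)).
rewrite -[_ *m _]/(_ * _) mk2M !mxE /= mul0r addr0 => /esym.
have l0 : l ^+ ex x != 0 by rewrite expf_neq0 // (repl_neq0 n_gt0).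
by move=> h; apply: (mulfI l0); rewrite h mulfV.
Qed.

(** The diagonal of rho(x^-1) is read off rho(x^-1) rho(x) = 1. A factor c becomes c^-1, while
    exchanging l and l^-1 preserves the trace. *)
Lemma rep2_trV x : \tr (rho l c x^-1%g) = \tr (rho l c^-1 x).
Proof.
have l0 := repl_neq0 n_gt0 l2n.
have Vc2 : c^-1 ^+ 2 = l ^+ n by rewrite exprVn c2 (repl_invn n_gt0).
have c0 : c != 0 by rewrite -[c == 0](expf_eq0 c 2) c2 expf_neq0.
have := rep2_M n_gt0 T8n_ab l2n c2 x^-1%g x; rewrite mulVg rep2_1 //.
rewrite -[_ *m _]/(_ * _) [rho l c x^-1%g]mk2_eta mk2_tr.
set p := _ 0 0; set q := _ 0 1; set r := _ 1 0; set s := _ 1 1.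
case: (T8n_expP n_gt0 T8n_ab x) => i j _ lt_j.
rewrite rep2_trE // rep2_formE // -[1%:M]/(1 : 'M[algC]_2) -mk2_1.
have li0 := expf_neq0 i l0.
have eqM (t u v w : algC) t' u' v' w' :
    mk2 t u v w = mk2 t' u' v' w' -> [/\ t = t', u = u', v = v' & w = w'].
  move=> e; have eE i1 i2 := congr1 (fun M : 'M_2 => M i1 i2) e.
  by split; [have := eE 0 0 | have := eE 0 1 | have := eE 1 0 | have := eE 1 1];
    rewrite !mxE.
case: j lt_j => [|[|[|[|//]]]] _; rewrite mk2M !(mulr0, addr0, add0r) => /eqM[e1 e2 e3 e4].
- have -> : p = l ^- i by apply: (mulIf li0); rewrite mulVf.
  have -> : s = l ^+ i by apply: (mulIf (invr_neq0 li0)); rewrite mulfV.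
  by rewrite addrC.
- have -> : p = 0 by apply: (mulIf (mulf_neq0 c0 li0)); rewrite mul0r.
  have -> : s = 0 by apply: (mulIf (invr_neq0 li0)); rewrite mul0r.
  by rewrite addr0.
- have -> : p = c^-1 * l ^- i.
    by apply: (mulIf (mulf_neq0 c0 li0)); rewrite -[LHS]e1 mulrACA !mulVf ?mulr1.
  have -> : s = c^-1 * l ^+ i.
    apply: (mulIf (mulf_neq0 c0 (invr_neq0 li0))).
    by rewrite -[LHS]e4 mulrACA mulVf ?mulfV ?mulr1.
  by rewrite addrC mulrDr.
- have -> : p = 0 by apply: (mulIf (mulf_neq0 (expf_neq0 2 c0) li0)); rewrite mul0r.
  have -> : s = 0 by apply: (mulIf (mulf_neq0 c0 (invr_neq0 li0))); rewrite mul0r.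
  by rewrite addr0.
Qed.

Lemma rep2_tr_invl x : \tr (rho l^-1 c x) = \tr (rho l c x).
Proof.
have Vl2n : l^-1 ^+ (2 * n) = 1 by rewrite exprVn l2n invr1.
have Vc2 : c ^+ 2 = l^-1 ^+ n by rewrite exprVn (repl_invn n_gt0).
case: (T8n_expP n_gt0 T8n_ab x) => i j _ lt_j.
rewrite !rep2_trE // exprVn invrK [l ^- i + _]addrC.
by [].
Qed.

End Fixed.

End CayleyT8n.

(* No dependence on c: on <[a]> the trace of rep2 is l ^+ r + l ^- r. *)
Definition tr1 n (gT : finGroupType) (a b : gT) (A : {set gT}) (l : algC) : algC :=
  \sum_(x in A) (l ^+ (T8n_exp n a b x).1 + l ^- (T8n_exp n a b x).1).

Definition tr2 n (gT : finGroupType) (a b : gT) (A : {set gT}) (l c : algC) : algC :=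
  char_sum_mul (fun x => \tr (rep2 n a b l c x)) A A.

(** * The image of the connection set in one representation *)

Section Connection.
Variables (n : nat) (n_gt0 : (0 < n)%N) (gT : finGroupType) (a b : gT).
Hypothesis T8n_ab : is_T8n n a b.
Variables S S1 S2 : {set gT}.
Hypotheses (defS : S = S1 :|: S2) (S_inv : S = [set x^-1%g | x in S]).
Hypothesis sS1 : S1 \subset <[(a ^+ 2)%g]>%g.
Hypothesis sS2 : S2 \subset (<[a]> :* b)%g :|: (<[a]> :* (b ^+ 3))%g.

Local Notation rho := (rep2 n a b).
Let ex x := (T8n_exp n a b x).1.
Local Notation P := (tr1 n a b S1).
Local Notation Q := (tr2 n a b S2).

Lemma S1_cycle x : x \in S1 -> x \in <[a]>%g.
Proof. by move/(subsetP sS1); apply/subsetP; rewrite cycle_subG mem_cycle. Qed.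

Lemma S1_even x : x \in S1 -> ~~ odd (ex x).
Proof.
move/(subsetP sS1) => /cycleP[m ->]; rewrite -expgM /ex (T8n_exp_a n_gt0 T8n_ab) /=.
have := divn_eq (2 * m) (2 * n) => /(congr1 odd); rewrite !oddM oddD !oddM /= andbF /=.
by move <-.
Qed.

Lemma S2_form x : x \in S2 -> exists r s, [/\ x = (a ^+ r * b ^+ s)%g, (s < 4)%N & odd s].
Proof.
move/(subsetP sS2); rewrite inE => /orP[] /rcosetP[_ /cycleP[r ->] ->].
  by exists r, 1.
by exists r, 3.
Qed.

Lemma S2_notin_cycle x : x \in S2 -> x \notin <[a]>%g.
Proof.
move=> /S2_form[r [s [-> lt_s odd_s]]]; apply/negP => /cycleP[m /(congr1 (T8n_exp n a b))].
rewrite (T8n_exp_a n_gt0 T8n_ab) (T8n_exp_norm n_gt0 T8n_ab) => -[_].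
by rewrite modn_small // => s0; rewrite s0 in odd_s.
Qed.

Lemma S_invV x : x \in S -> x^-1%g \in S.
Proof. by move=> xS; rewrite S_inv; apply: imset_f. Qed.

(** [S1] lies inside <[a]> and [S2] outside, so closure under inverses passes from [S] to each. *)
Lemma S1V x : x \in S1 -> x^-1%g \in S1.
Proof.
move=> xS1; have : x^-1%g \in S by rewrite S_invV // defS inE xS1.
rewrite defS inE => /orP[//|/S2_notin_cycle].
by rewrite groupV S1_cycle.
Qed.

Lemma S2V x : x \in S2 -> x^-1%g \in S2.
Proof.
move=> xS2; have : x^-1%g \in S by rewrite S_invV // defS inE xS2 orbT.
rewrite defS inE => /orP[/S1_cycle|//].
by rewrite groupV (negPf (S2_notin_cycle xS2)).
Qed.

Lemma sum_S (V : nmodType) (F : gT -> V) :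
  \sum_(x in S) F x = \sum_(x in S1) F x + \sum_(x in S2) F x.
Proof.
rewrite defS -bigU //=; last first.
  rewrite -setI_eq0; apply/eqP/setP => x; rewrite !inE.
  by apply/andP => -[/S1_cycle xa /S2_notin_cycle]; rewrite xa.
by apply: eq_bigl => x; rewrite inE.
Qed.

Section Fixed.
Variables l c : algC.
Hypotheses (l2n : l ^+ (2 * n) = 1) (c2 : c ^+ 2 = l ^+ n).

Lemma sum_S1V : \sum_(x in S1) l ^- ex x = \sum_(x in S1) l ^+ ex x.
Proof.
rewrite [RHS](reindex_inj invg_inj) /=; apply: eq_big => [x|x xS1].
  by apply/idP/idP => /S1V; rewrite ?invgK.
by rewrite (T8n_exV n_gt0 T8n_ab l2n c2) ?S1_cycle.
Qed.

Lemma tr1E : P l = 2 * \sum_(x in S1) l ^+ ex x.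
Proof. by rewrite /tr1 big_split /= sum_S1V mulr_natl. Qed.

Lemma block_eigenvalueP z :
  reflect ((2 * z - P l) ^+ 2 = 2 * Q l c) (eigenvalue (\sum_(x in S) rho l c x) z).
Proof.
set al := \sum_(x in S1) l ^+ ex x.
have -> : \sum_(x in S) rho l c x = mk2 al 0 0 al + \sum_(x in S2) rho l c x.
  rewrite sum_S; congr (_ + _).
  rewrite (eq_bigr _ (fun x xS1 => rep2_cycle n_gt0 T8n_ab l2n c2 (S1_cycle xS1))).
  have sumE i j := summxE (index_enum gT) (mem S1) (fun x => mk2 (l ^+ ex x) 0 0 (l ^- ex x)) i j.
  rewrite [LHS]mk2_eta !sumE.
  by congr mk2; under eq_bigr do rewrite mxE /=; rewrite ?big1_eq ?sum_S1V.
(* Counting pairs with multiplicity makes [Q] the trace of the square of the [S2] part, which is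
   antidiagonal. *)
have QE : Q l c = \tr ((\sum_(x in S2) rho l c x) * (\sum_(x in S2) rho l c x)).
  rewrite /tr2 /char_sum_mul mulr_suml raddf_sum; apply: eq_bigr => x _.
  rewrite mulr_sumr raddf_sum; apply: eq_bigr => y _.
  by rewrite (rep2_M n_gt0 T8n_ab l2n c2).
set N := \sum_(x in S2) _ in QE *.
have diag0 (i : 'I_2) : N i i = 0.
  rewrite summxE big1 // => x /S2_form[r [s [-> lt_s odd_s]]].
  rewrite rep2_formE //; case: s lt_s odd_s => [|[|[|[|//]]]] // _ _;
    by rewrite mxE; have [->|->] := ord2P i.
have NE := mk2_eta N; rewrite !diag0 in NE.
have -> : mk2 al 0 0 al + N = mk2 al (N 0 1) (N 1 0) al.
  apply/matrixP => i j; rewrite mxE {1}NE !mxE.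
  by have [->|->] := ord2P i; have [->|->] := ord2P j; rewrite /= ?addr0 ?add0r.
rewrite QE NE mk2M mk2_tr tr1E -/al !mxE /=.
apply: (iffP (mk2_eigenvalueP _ _ _ _)) => [zE | zE].
  transitivity (4 * (z - al) ^+ 2); first ring.
  by rewrite zE; ring.
apply: (mulfI (_ : (4 : algC) != 0)); first by rewrite pnatr_eq0.
transitivity ((2 * z - 2 * al) ^+ 2); first ring.
by rewrite zE; ring.
Qed.

Lemma tr1_inv : P l^-1 = P l.
Proof. by apply: eq_bigr => x _; rewrite exprVn invrK addrC. Qed.

Lemma tr1_opp : P (- l) = P l.
Proof.
apply: eq_bigr => x /S1_even even_x.
by rewrite exprNn -signr_odd (negPf even_x) mul1r.
Qed.

Lemma tr2_inv : Q l^-1 c = Q l c.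
Proof.
by apply: eq_bigr => x _; apply: eq_bigr => y _; rewrite (rep2_tr_invl n_gt0).
Qed.

(* For n odd the psi_h only realise c = 'i; the blocks with c = - 'i are reached
   through this symmetry, which comes from S2 = S2^-1. *)
Lemma tr2_cinv : Q l c^-1 = Q l c.
Proof.
rewrite /tr2 /char_sum_mul [RHS](reindex_inj invg_inj) exchange_big /=.
have S2E x : (x^-1%g \in S2) = (x \in S2) by apply/idP/idP => /S2V; rewrite ?invgK.
rewrite (eq_bigl _ _ S2E); apply: eq_bigr => y _.
rewrite [RHS](reindex_inj invg_inj) (eq_bigl _ _ S2E) /=; apply: eq_bigr => x _.
by rewrite -invMg (rep2_trV n_gt0 T8n_ab l2n c2).
Qed.

End Fixed.

End Connection.

(** * The given characters inside the blocks *)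

Lemma phiE n k (n_gt0 : (0 < n)%N) (gT : finGroupType) (a b : gT) x :
  is_T8n n a b -> phi n a b k x = \tr (rep2 n a b (phi_l n k) (phi_c n k) x).
Proof.
move=> T8n_ab; rewrite /phi; case: (T8n_expP n_gt0 T8n_ab x) => r s _ lt_s.
by rewrite phi_valE // rep2_trE ?phi_l_2n ?phi_c_sqr.
Qed.

Lemma psiE n h (n_gt0 : (0 < n)%N) (gT : finGroupType) (a b : gT) x :
  is_T8n n a b -> psi n a b h x = \tr (rep2 n a b (psi_l n h) (psi_c n h) x).
Proof.
move=> T8n_ab; rewrite /psi; case: (T8n_expP n_gt0 T8n_ab x) => r s _ lt_s.
by rewrite psi_valE // rep2_trE ?psi_l_2n ?psi_c_sqr.
Qed.

Lemma char_sum_mul_eq (gT : finGroupType) (f g : gT -> algC) (A B : {set gT}) :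
  f =1 g -> char_sum_mul f A B = char_sum_mul g A B.
Proof. by move=> fg; apply: eq_bigr => x _; apply: eq_bigr. Qed.

(* For l = 1 or -1 the block is reducible: (1, beta) spans a stable line. *)
Lemma chi_eigenvalue n j (n_gt0 : (0 < n)%N) (gT : finGroupType) (a b : gT) (A : {set gT}) :
    is_T8n n a b ->
  eigenvalue (\sum_(x in A) rep2 n a b (chi_l n j) (chi_b n j ^+ 2) x)
    (char_sum (chi n a b j) A).
Proof.
move=> T8n_ab; set l := chi_l n j; set beta := chi_b n j.
have l2 : l ^+ 2 = 1 := chi_l_sqr n j.
have l2n : l ^+ (2 * n) = 1 by rewrite exprM l2 expr1n.
have c2 : (beta ^+ 2) ^+ 2 = l ^+ n by rewrite -exprM chi_b_exp4.
have Vl r : l ^- r = l ^+ r.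
  have l0 := repl_neq0 n_gt0 l2n.
  by apply: (mulfI (expf_neq0 r l0)); rewrite mulfV ?expf_neq0 // -expr2 exprAC l2 expr1n.
pose v : 'rV[algC]_2 := \row_i if i == 0 then 1 else beta.
apply/eigenvalueP; exists v; last first.
  by apply/eqP => /rowP/(_ 0)/eqP; rewrite !mxE oner_eq0.
rewrite mulmx_sumr scaler_suml; apply: eq_bigr => x _; rewrite /chi.
case: (T8n_expP n_gt0 T8n_ab x) => r s _ lt_s; rewrite chi_valE -/l -/beta rep2_formE //.
have mulE p q t u : v *m mk2 p q t u = \row_i if i == 0 then p + beta * t else q + beta * u.
  have l1 : lift ord0 ord0 = 1 :> 'I_2 by apply/val_inj.
  apply/rowP => i; rewrite !mxE !big_ord_recl big_ord0 addr0 !mxE /= ?l1.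
  by have [->|->] := ord2P i; rewrite /= !mul1r.
case: s lt_s => [|[|[|[|//]]]] _; rewrite mulE; apply/rowP => i; rewrite !mxE Vl;
  have [->|->] := ord2P i; rewrite /=; ring.
Qed.

(** * Integrality block by block *)

Section Criterion.
Variables (n : nat) (n_gt0 : (0 < n)%N) (gT : finGroupType) (a b : gT).
Hypothesis T8n_ab : is_T8n n a b.
Variables S S1 S2 : {set gT}.
Hypotheses (defS : S = S1 :|: S2) (S_inv : S = [set x^-1%g | x in S]).
Hypothesis sS1 : S1 \subset <[(a ^+ 2)%g]>%g.
Hypothesis sS2 : S2 \subset (<[a]> :* b)%g :|: (<[a]> :* (b ^+ 3))%g.

Local Notation P := (tr1 n a b S1).
Local Notation Q := (tr2 n a b S2).

Let blockP := block_eigenvalueP n_gt0 T8n_ab defS S_inv sS1 sS2.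

Lemma block_cay l c z : l ^+ (2 * n) = 1 -> c ^+ 2 = l ^+ n ->
  eigenvalue (\sum_(x in S) rep2 n a b l c x) z -> eigenvalue (adjmx (cay_rel S)) z.
Proof.
move=> l2n c2; apply: rep_cay_eigenvalue; first exact: rep2_1.
exact: rep2_M.
Qed.

(** If no block had the eigenvalue z, all Fourier coefficients of an eigenfunction would vanish. The
    doubly negated form suffices for the boolean goal [z \in Num.int]. *)
Lemma cay_block z : eigenvalue (adjmx (cay_rel S)) z ->
  ~ (forall l c, l ^+ (2 * n) = 1 -> c ^+ 2 = l ^+ n ->
       ~~ eigenvalue (\sum_(x in S) rep2 n a b l c x) z).
Proof.
move=> /cay_eigenvalueP[f [y fy] fS] noE; case/eqP: fy.
(* The coefficients in [cay_rep_eigenvalue] use rho(x^-1), so completeness is applied to f composed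
   with inversion. *)
rewrite -[y]invgK; apply: (rep2_complete n_gt0 T8n_ab (f := fun x => f x^-1%g)).
move=> l c l2n c2; rewrite (reindex_inj invg_inj) /=; apply/eqP.
apply: contraNT (noE l c l2n c2); under eq_bigr do rewrite invgK.
by apply: cay_rep_eigenvalue => //; apply: rep2_M.
Qed.

(** The block has eigenvalues (P + w) / 2 and (P - w) / 2 with w^2 = 2 Q; their sum is P and their
    difference w. *)
Lemma integral_tr l c : integral_graph (cay_rel S) ->
    l ^+ (2 * n) = 1 -> c ^+ 2 = l ^+ n ->
  P l \in Num.int /\ perfect_square (2%:R * Q l c).
Proof.
move=> intS l2n c2; set w := sqrtC (2 * Q l c).
have w2 : w ^+ 2 = 2 * Q l c by rewrite sqrtCK.
have two0 : (2 : algC) != 0 by rewrite pnatr_eq0.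
have int_half z : (2 * z - P l) ^+ 2 = 2 * Q l c -> z \in Num.int.
  by move=> /(blockP l2n c2)/(block_cay l2n c2)/intS.
have z1 : (P l + w) / 2 \in Num.int.
  by apply: int_half; rewrite mulrC divfK // addrC addKr.
have z2 : (P l - w) / 2 \in Num.int.
  by apply: int_half; rewrite mulrC divfK // addrC addKr sqrrN.
split.
  have -> : P l = (P l + w) / 2 + (P l - w) / 2 by field.
  exact: rpredD.
have : w \in Num.int.
  have -> : w = (P l + w) / 2 - (P l - w) / 2 by field.
  exact: rpredB.
by case/intrP => m wm; exists m; rewrite -w2 wm rmorphXn.
Qed.

Lemma eigenvalue_int l c z : z \in Aint -> 
    l ^+ (2 * n) = 1 -> c ^+ 2 = l ^+ n ->
    P l \in Num.int -> perfect_square (2%:R * Q l c) ->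
    eigenvalue (\sum_(x in S) rep2 n a b l c x) z ->
  z \in Num.int.
Proof.
move=> Az l2n c2 Pint [m Qm] /(blockP l2n c2); rewrite Qm rmorphXn => /sqr_pm zE.
apply: Cint_rat_Aint => //.
have Q2 : (2 : algC) \in Crat by apply: rpred_nat.
have -> : z = (2 * z - P l + P l) / 2 by field.
rewrite rpred_div // rpredD //; last exact: rpred_int_num.
by case: zE => ->; rewrite ?rpredN rpred_int.
Qed.

End Criterion.

(** * Assembling the blocks into the equivalence *)

Theorem theorem4p2 (n : nat) (n_gt0 : (0 < n)%N)
    (gT : finGroupType) (a b : gT) (T8n_ab : is_T8n n a b)
    (S S1 S2 : {set gT})
    (defS : S = S1 :|: S2)
    (S_neq0 : S != set0)
    (S_not1 : 1%g \notin S)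
    (S_inv : S = [set x^-1%g | x in S])
    (sS1 : S1 \subset <[(a ^+ 2)%g]>%g)
    (sS2 : S2 \subset (<[a]> :* b)%g :|: (<[a]> :* (b ^+ 3))%g) :
  integral_graph (cay_rel S) <->
  [/\ in_B <[(a ^+ 2)%g]>%G S1,
      (forall j : nat, (j <= 7)%N ->
         char_sum (chi n a b j) S \in Num.int) /\
      (forall k : nat, (1 <= k <= n.-1)%N ->
         char_sum (phi n a b k) S1 \in Num.int) &
      (forall k : nat, (1 <= k <= n.-1)%N ->
         perfect_square (2%:R * char_sum_mul (phi n a b k) S2 S2)) /\
      (forall h : nat, (1 <= h <= n.-1)%N ->
         perfect_square (2%:R * char_sum_mul (psi n a b h) S2 S2))].
Proof.
have phi_sq k : char_sum_mul (phi n a b k) S2 S2 = tr2 n a b S2 (phi_l n k) (phi_c n k).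
  by apply: char_sum_mul_eq => x; rewrite phiE.
have psi_sq h : char_sum_mul (psi n a b h) S2 S2 = tr2 n a b S2 (psi_l n h) (psi_c n h).
  by apply: char_sum_mul_eq => x; rewrite psiE.
have phi_S1 k : char_sum (phi n a b k) S1 = tr1 n a b S1 (phi_l n k).
  apply: eq_bigr => x xS1; rewrite phiE // rep2_cycle ?phi_l_2n ?phi_c_sqr ?mk2_tr //.
  exact: S1_cycle xS1.
have sS1a : S1 \subset <[a]>%g by apply/subsetP => x; apply: S1_cycle.
split=> [intS | [_ [chi_int phi_int] [phi_sqr psi_sqr]]].
  have tr_int l c := integral_tr n_gt0 T8n_ab defS S_inv sS1 sS2 (l := l) (c := c) intS.
  split; last 1 first.
  - split=> k _; rewrite ?phi_sq ?psi_sq.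
      by case: (tr_int _ _ (phi_l_2n n_gt0 k) (phi_c_sqr n_gt0 k)).
    by case: (tr_int _ _ (psi_l_2n n_gt0 k) (psi_c_sqr n_gt0 k)).
  - apply: generator_closed_in_B => //.
    apply: (rational_generator_closed n_gt0 T8n_ab sS1a) => l l2n.
    have c2 := sqrtCK (l ^+ n); have [Pint _] := tr_int _ _ l2n c2.
    have two0 : (2 : algC) != 0 by rewrite pnatr_eq0.
    have P2 := tr1E n_gt0 T8n_ab defS S_inv sS1 sS2 l2n c2.
    rewrite -[\sum_(x in _) _](mulKf two0) -P2 mulrC.
    by rewrite rpred_div ?rpred_nat // rpred_int_num.
  split=> [j _ | k _].
    apply: intS; apply: block_cay (chi_eigenvalue _ n_gt0 _ T8n_ab) => //.
      by rewrite exprM chi_l_sqr expr1n.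
    by rewrite -exprM chi_b_exp4.
  by rewrite phi_S1; case: (tr_int _ _ (phi_l_2n n_gt0 k) (phi_c_sqr n_gt0 k)).
move=> z z_eig; apply: contraT => zN; exfalso.
apply: (cay_block n_gt0 T8n_ab z_eig) => l c l2n c2; apply: contra zN => z_lc.
have Az := cay_eigenvalue_Aint z_eig.
have blockP := block_eigenvalueP n_gt0 T8n_ab defS S_inv sS1 sS2.
have [l2|l2] := eqVneq (l ^+ 2) 1.
  (* Here l is 1 or -1, and a square root beta of c satisfies beta^4 = l^n, so some chi_j takes the
     values l at a and beta at b. *)
  have beta2 := sqrtCK c; set beta := sqrtC c in beta2.
  have [j j7 [lE bE]] : exists2 j, (j <= 7)%N & l = chi_l n j /\ beta = chi_b n j.
    by apply: chi_surj; rewrite // -c2 -beta2 -exprM.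
  have := chi_eigenvalue j n_gt0 S T8n_ab; rewrite -lE -bE beta2.
  move=> /(blockP l c l2n c2) chiE; move/(blockP l c l2n c2): z_lc; rewrite -chiE.
  have P2 := tr1E n_gt0 T8n_ab defS S_inv sS1 sS2 l2n c2.
  set al := \sum_(x in S1) _ in P2; rewrite P2.
  have al_int : al \in Num.int.
    apply: rpred_sum => x _; apply: rpredX.
    by move/eqP: l2; rewrite sqrf_eq1 => /orP[]/eqP->; rewrite ?rpredN rpred1.
  have two0 : (2 : algC) != 0 by rewrite pnatr_eq0.
  have chi_j := chi_int j j7; set w := char_sum _ _ in chi_j *.
  (* Both z and w = chi_j(S) solve the block equation, so z is w or 2 al - w. *)
  rewrite -!mulrBr !exprMn => /(mulfI (expf_neq0 2 two0))/sqr_pm[] zE.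
    by have -> : z = w by rewrite -[z](subrK al) zE subrK.
  have -> : z = 2 * al - w by rewrite -[z](subrK al) zE; ring.
  by rewrite rpredB // rpredM // rpred_nat.
apply: (eigenvalue_int n_gt0 T8n_ab defS S_inv sS1 sS2 Az l2n c2 _ _ z_lc).
  (* [P] is unchanged under l -> l^-1 and l -> -l, so its integrality comes from some phi_k(S1). *)
  have [k lt_k lk] := phi_l_cover n_gt0 l2n l2.
  have := phi_int k lt_k; rewrite phi_S1; case: lk => <- //.
    by rewrite tr1_inv.
  by rewrite (tr1_opp n_gt0 T8n_ab sS1).
have [k lt_k [[lk ck]|[lk ck]]] := phi_psi_surj n_gt0 l2n l2 c2.
  have := phi_sqr k lt_k; rewrite phi_sq -ck; case: lk => <- //.
  by rewrite tr2_inv.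
have Vl2n : l^-1 ^+ (2 * n) = 1 by rewrite exprVn l2n invr1.
have QVc := tr2_cinv n_gt0 T8n_ab defS S_inv sS1 sS2.
have := psi_sqr k lt_k; rewrite psi_sq.
(* [tr2_inv] absorbs an inverse in l here, and [tr2_cinv] one in c afterwards. *)
have -> : tr2 n a b S2 (psi_l n k) (psi_c n k) = tr2 n a b S2 l (psi_c n k).
  case: lk => lk; rewrite -lk //; rewrite tr2_inv //.
  by rewrite psi_c_sqr // -lk exprVn (repl_invn n_gt0).
by case: ck => <- //; rewrite QVc.
Qed.
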